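(* The para-octonionic projective plane $\mathbb O'P^2$ with the semi-Riemannian metric $g$ below is homogeneous, i.e. its isometry group acts transitively.
   Context: Para-octonions $\mathbb O'=\mathbb H\oplus\mathbb H$ with product $(q_1,q_2)(p_1,p_2)=(q_1p_1+\bar p_2q_2,\ p_2q_1+q_2\bar p_1)$, conjugation $\overline{(q_1,q_2)}=(\bar q_1,-q_2)$, $\langle a,b\rangle=\mathrm{Re}(a\bar b)$, $|a|^2=\langle a,a\rangle$. $\mathbb O'P^2=\mathcal U/_\sim$ where $\mathcal U=\{(1,y,z):1+|y|^2+|z|^2>0\}\cup\{(x,1,z):|x|^2+1+|z|^2>0\}\cup\{(x,y,1):|x|^2+|y|^2+1>0\}$ and $[a,b,c]\sim[d,e,f]$ iff $(a,b,c)=(d\lambda,e\lambda,f\lambda)$ for some $\lambda$ with $|\lambda|^2>0$; charts $[1,u,v]\mapsto(u,v)$, $[u,1,v]\mapsto(u,v)$, $[u,v,1]\mapsto(u,v)$. The metric $g$ (of signature $(8,8)$) is given on each chart, for tangent vector $(du,dv)=(\xi,\eta)$, by $ds^2=\frac{|\xi|^2(1+|v|^2)+|\eta|^2(1+|u|^2)-2\mathrm{Re}[(u\bar v)(\eta\bar\xi)]}{(1+|u|^2+|v|^2)^2}$. *)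

(* Defs.v *)
From HB Require Import structures.
From mathcomp Require Import all_boot all_order all_algebra.
From mathcomp Require Import all_classical all_reals all_analysis.
From Stdlib Require Relation_Operators.
Set Implicit Arguments. Unset Strict Implicit. Unset Printing Implicit Defensive.
Import Order.TTheory GRing.Theory Num.Theory.
Import numFieldNormedType.Exports.
Local Open Scope classical_set_scope.
Local Open Scope ring_scope.

Section ParaOctonionicPlane.
Variable R : realType.

Record quat := Quat { qr : R; qi : R; qj : R; qk : R }.
Definition qzero : quat := Quat 0 0 0 0.
Definition qone : quat := Quat 1 0 0 0.
Definition qadd (p q : quat) : quat :=
  Quat (qr p + qr q) (qi p + qi q) (qj p + qj q) (qk p + qk q).
Definition qopp (p : quat) : quat := Quat (- qr p) (- qi p) (- qj p) (- qk p).
Definition qmul (p q : quat) : quat :=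
  Quat (qr p * qr q - qi p * qi q - qj p * qj q - qk p * qk q)
       (qr p * qi q + qi p * qr q + qj p * qk q - qk p * qj q)
       (qr p * qj q - qi p * qk q + qj p * qr q + qk p * qi q)
       (qr p * qk q + qi p * qj q - qj p * qi q + qk p * qr q).
Definition qconj (p : quat) : quat := Quat (qr p) (- qi p) (- qj p) (- qk p).

Record oct := Oct { o1 : quat; o2 : quat }.
Definition oone : oct := Oct qone qzero.
Definition omul (a b : oct) : oct :=
  Oct (qadd (qmul (o1 a) (o1 b)) (qmul (qconj (o2 b)) (o2 a)))
      (qadd (qmul (o2 b) (o1 a)) (qmul (o2 a) (qconj (o1 b)))).
Definition oconj (a : oct) : oct := Oct (qconj (o1 a)) (qopp (o2 a)).
Definition ore (a : oct) : R := qr (o1 a).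
Definition oip (a b : oct) : R := ore (omul a (oconj b)).
Definition onorm2 (a : oct) : R := oip a a.

Definition trip := (oct * oct * oct)%type.

Definition inU (t : trip) : Prop :=
  let '(a, b, c) := t in
     (a = oone /\ 0 < 1 + onorm2 b + onorm2 c)
  \/ (b = oone /\ 0 < onorm2 a + 1 + onorm2 c)
  \/ (c = oone /\ 0 < onorm2 a + onorm2 b + 1).

Definition sim (t s : trip) : Prop :=
  let '(a, b, c) := t in let '(d, e, f) := s in
  exists l : oct, 0 < onorm2 l /\ a = omul d l /\ b = omul e l /\ c = omul f l.

Definition simU (t s : trip) : Prop := inU t /\ inU s /\ sim t s.

(** Equivalence class of t in U (w.r.t. the equivalence relation generated
    by ~ on U; it coincides with ~ since ~ is an equivalence relation). *)
Definition eqclass (t : trip) : set trip :=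
  [set s | inU s /\ Relation_Operators.clos_refl_sym_trans trip simU s t].

Definition is_point (S : set trip) : Prop :=
  exists t, inU t /\ S = eqclass t.

Definition V16 := 'rV[R]_16.

Definition oct_of_row (x : V16) (k : nat) : oct :=
  Oct (Quat (x 0 (inord k)) (x 0 (inord (k + 1)%N)) (x 0 (inord (k + 2)%N)) (x 0 (inord (k + 3)%N)))
      (Quat (x 0 (inord (k + 4)%N)) (x 0 (inord (k + 5)%N)) (x 0 (inord (k + 6)%N)) (x 0 (inord (k + 7)%N))).
Definition uOf (x : V16) : oct := oct_of_row x 0.
Definition vOf (x : V16) : oct := oct_of_row x 8.

Definition emb (i : 'I_3) (x : V16) : trip :=
  match nat_of_ord i with
  | 0%N => (oone, uOf x, vOf x)
  | 1%N => (uOf x, oone, vOf x)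
  | _ => (uOf x, vOf x, oone)
  end.

Definition chart_dom (i : 'I_3) : set V16 := [set x | inU (emb i x)].

Definition psi (i : 'I_3) (x : V16) : set trip := eqclass (emb i x).

Definition in_chart (i : 'I_3) (p : set trip) : Prop := exists x, p (emb i x).

Definition phi (i : 'I_3) (p : set trip) : V16 := xget 0 [set x | p (emb i x)].

(** The metric g in chart coordinates (same formula in every chart). *)
Definition ds2 (x xi : V16) : R :=
  let u := uOf x in let v := vOf x in
  let dx := uOf xi in let dy := vOf xi in
  (onorm2 dx * (1 + onorm2 v) + onorm2 dy * (1 + onorm2 u)
     - 2 * ore (omul (omul u (oconj v)) (omul dy (oconj dx))))
  / (1 + onorm2 u + onorm2 v) ^+ 2.

Fixpoint iterD (vs : seq V16) (f : V16 -> V16) : V16 -> V16 :=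
  match vs with
  | [::] => f
  | v :: vs' => fun x => 'D_v (iterD vs' f) x
  end.

Definition smooth_on (A : set V16) (f : V16 -> V16) : Prop :=
  forall (vs : seq V16) (x : V16), A x ->
    {for x, continuous (iterD vs f)} /\ (forall v, derivable (iterD vs f) x v).

Definition loc (F : set trip -> set trip) (i j : 'I_3) (x : V16) : V16 :=
  phi j (F (psi i x)).
Definition locdom (F : set trip -> set trip) (i j : 'I_3) : set V16 :=
  [set x | chart_dom i x /\ in_chart j (F (psi i x))].

Definition smooth_map (F : set trip -> set trip) : Prop :=
  (forall p, is_point p -> is_point (F p)) /\
  forall i j : 'I_3, open (locdom F i j) /\ smooth_on (locdom F i j) (loc F i j).

Definition diffeomorphism (F : set trip -> set trip) : Prop :=
  smooth_map F /\
  exists G : set trip -> set trip, smooth_map G /\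
    (forall p, is_point p -> G (F p) = p) /\ (forall p, is_point p -> F (G p) = p).

Definition preserves_metric (F : set trip -> set trip) : Prop :=
  forall (i j : 'I_3) (x : V16), locdom F i j x ->
    forall xi : V16, ds2 (loc F i j x) ('D_xi (loc F i j) x) = ds2 x xi.

Definition opp_isometry (F : set trip -> set trip) : Prop :=
  diffeomorphism F /\ preserves_metric F.

End ParaOctonionicPlane.

(* Main.v *)
Require Import Defs.
From mathcomp Require Import all_boot all_order all_algebra.
From mathcomp Require Import all_classical all_reals all_analysis.
From mathcomp Require Import ring lra.
Set Implicit Arguments. Unset Strict Implicit. Unset Printing Implicit Defensive.
Import Order.TTheory GRing.Theory Num.Theory.
Import numFieldNormedType.Exports.
Local Open Scope classical_set_scope.
Local Open Scope ring_scope.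

(* A point [v] of the plane is the Hermitian matrix [A = v v^* / |v|^2]: the
   points are the trace one solutions of the rank one equations, and a chart is
   the locus where one diagonal entry is positive.  Conjugation by a matrix with
   block rows (r, s), (s^*, -r), where r^2 + |s|^2 = 1, and cyclic permutations of
   the indices preserve these equations and the trace form.  Two of the diagonal
   entries of [A] have a positive sum, so one such conjugation kills a row, and a
   second one brings [A] to a fixed diagonal idempotent: the action is transitive.

   In every chart the trace form of two points [x], [y] equals
   1 - n(x, y - x) / (D(x) D(y)), where ds^2 = n / D^2, exactly and not only to
   second order.  Hence a map that preserves the trace form preserves ds^2, as one
   sees by dividing by h^2 in [y = x + h xi].  In charts the maps are rational,
   hence smooth. *)

(** * Para-octonions *)

Definition oadd (R : realType) (x y : oct R) : oct R :=
  Oct (qadd (o1 x) (o1 y)) (qadd (o2 x) (o2 y)).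
Definition qscale (R : realType) (k : R) (p : quat R) : quat R :=
  Quat (k * qr p) (k * qi p) (k * qj p) (k * qk p).
Definition oscale (R : realType) (k : R) (x : oct R) : oct R :=
  Oct (qscale k (o1 x)) (qscale k (o2 x)).

Ltac oct_ring :=
  rewrite /omul /oadd /oscale /oconj /oone /qscale /qadd /qmul
    /qconj /qopp /qone /qzero /=; try (congr Oct; congr Quat); ring.

Section Octonions.
Context {R : realType}.
Implicit Types (k r : R) (s w x y z : oct R).

Lemma oipE x y : oip x y =
  qr (o1 x) * qr (o1 y) + qi (o1 x) * qi (o1 y)
  + qj (o1 x) * qj (o1 y) + qk (o1 x) * qk (o1 y)
  - qr (o2 x) * qr (o2 y) - qi (o2 x) * qi (o2 y)
  - qj (o2 x) * qj (o2 y) - qk (o2 x) * qk (o2 y).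
Proof. rewrite /oip /ore; oct_ring. Qed.

Lemma oscaleA k r x : oscale k (oscale r x) = oscale (k * r) x. Proof. oct_ring. Qed.
Lemma oscale1 x : oscale 1 x = x.
Proof. case: x => [[? ? ? ?] [? ? ? ?]]; oct_ring. Qed.
Lemma omulDl x y z : omul (oadd x y) z = oadd (omul x z) (omul y z).
Proof. oct_ring. Qed.
Lemma omulDr x y z : omul x (oadd y z) = oadd (omul x y) (omul x z).
Proof. oct_ring. Qed.
Lemma omulZl k x y : omul (oscale k x) y = oscale k (omul x y).
Proof. oct_ring. Qed.
Lemma omulZr k x y : omul x (oscale k y) = oscale k (omul x y).
Proof. oct_ring. Qed.
Lemma omul1l x : omul (oone R) x = x.
Proof. case: x => [[? ? ? ?] [? ? ? ?]]; oct_ring. Qed.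
Lemma omul1r x : omul x (oone R) = x.
Proof. case: x => [[? ? ? ?] [? ? ? ?]]; oct_ring. Qed.
Lemma oconj1 : oconj (oone R) = oone R. Proof. oct_ring. Qed.
Lemma oconjK x : oconj (oconj x) = x.
Proof. case: x => [[? ? ? ?] [? ? ? ?]]; oct_ring. Qed.
Lemma oconjD x y : oconj (oadd x y) = oadd (oconj x) (oconj y).
Proof. oct_ring. Qed.
Lemma oconjZ k x : oconj (oscale k x) = oscale k (oconj x).
Proof. oct_ring. Qed.
Lemma oconjM x y : oconj (omul x y) = omul (oconj y) (oconj x).
Proof. oct_ring. Qed.

Lemma oipC x y : oip x y = oip y x. Proof. rewrite !oipE; ring. Qed.
Lemma oipDl x y z : oip (oadd x y) z = oip x z + oip y z.
Proof. rewrite !oipE /=; ring. Qed.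
Lemma oipDr x y z : oip x (oadd y z) = oip x y + oip x z.
Proof. rewrite !oipE /=; ring. Qed.
Lemma oipZl k x y : oip (oscale k x) y = k * oip x y.
Proof. rewrite !oipE /=; ring. Qed.
Lemma oipZr k x y : oip x (oscale k y) = k * oip x y.
Proof. rewrite !oipE /=; ring. Qed.
Lemma oip_conj x y : oip (oconj x) (oconj y) = oip x y.
Proof. rewrite !oipE /=; ring. Qed.

(** Nondegeneracy, tested on the basis vectors. Equations between octonions are later paired with an
    arbitrary [w], which turns them into scalar identities within reach of [ring]. *)
Lemma oip_inj x y : (forall w, oip x w = oip y w) -> x = y.
Proof.
case: x y => [[x0 x1 x2 x3] [x4 x5 x6 x7]] [[y0 y1 y2 y3] [y4 y5 y6 y7]] h.
have e a0 a1 a2 a3 a4 a5 a6 a7 := h (Oct (Quat a0 a1 a2 a3) (Quat a4 a5 a6 a7)).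
congr Oct; congr Quat.
- by move: (e 1 0 0 0 0 0 0 0); rewrite !oipE /=; lra.
- by move: (e 0 1 0 0 0 0 0 0); rewrite !oipE /=; lra.
- by move: (e 0 0 1 0 0 0 0 0); rewrite !oipE /=; lra.
- by move: (e 0 0 0 1 0 0 0 0); rewrite !oipE /=; lra.
- by move: (e 0 0 0 0 1 0 0 0); rewrite !oipE /=; lra.
- by move: (e 0 0 0 0 0 1 0 0); rewrite !oipE /=; lra.
- by move: (e 0 0 0 0 0 0 1 0); rewrite !oipE /=; lra.
- by move: (e 0 0 0 0 0 0 0 1); rewrite !oipE /=; lra.
Qed.

Lemma oip_mull x y z : oip (omul x y) z = oip y (omul (oconj x) z).
Proof. rewrite !oipE; oct_ring. Qed.
Lemma oip_mulr x y z : oip (omul x y) z = oip x (omul z (oconj y)).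
Proof. by rewrite -oip_conj oconjM oip_mull oconjK oipC -oip_conj oconjM oconjK oipC oconjK. Qed.

(** Left alternativity, checked in coordinates. With the adjunction [oip_mull] it gives the
    composition law [onorm2M], and conjugation turns it into the right-handed versions. *)
Lemma omulKl x y : omul (oconj x) (omul x y) = oscale (onorm2 x) y.
Proof.
rewrite /onorm2 oipE.
case: x y => [[? ? ? ?] [? ? ? ?]] [[? ? ? ?] [? ? ? ?]] /=.
by rewrite /oscale /omul /=; congr Oct; rewrite /qscale /qadd /qmul /=; congr Quat; ring.
Qed.

Lemma onorm2_conj x : onorm2 (oconj x) = onorm2 x.
Proof. exact: oip_conj. Qed.
Lemma onorm2Z k x : onorm2 (oscale k x) = k ^+ 2 * onorm2 x.
Proof. by rewrite /onorm2 oipZl oipZr mulrA. Qed.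
Lemma onorm2D x y : onorm2 (oadd x y) = onorm2 x + 2 * oip x y + onorm2 y.
Proof. rewrite /onorm2 !oipDl !oipDr (oipC y x); ring. Qed.
Lemma onorm2_1 : onorm2 (oone R) = 1.
Proof. rewrite /onorm2 oipE /=; ring. Qed.
Lemma onorm2M x y : onorm2 (omul x y) = onorm2 x * onorm2 y.
Proof. by rewrite {1}/onorm2 oip_mull omulKl oipZr. Qed.

Lemma omulVKl x y : omul x (omul (oconj x) y) = oscale (onorm2 x) y.
Proof. by have := omulKl (oconj x) y; rewrite oconjK onorm2_conj. Qed.
Lemma omulKr x y : omul (omul y x) (oconj x) = oscale (onorm2 x) y.
Proof.
by apply: (can_inj oconjK); rewrite !oconjM oconjK omulVKl oconjZ.
Qed.
Lemma omulVKr x y : omul (omul y (oconj x)) x = oscale (onorm2 x) y.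
Proof. by have := omulKr (oconj x) y; rewrite oconjK onorm2_conj. Qed.

(** Polarisation of [omulKl]: apply it to [oadd y x] and cancel the two diagonal terms. *)
Lemma omul_altl x y z : omul (oconj x) (omul y z) =
  oadd (oscale (2 * oip y x) z) (oscale (-1) (omul (oconj y) (omul x z))).
Proof.
have := omulKl (oadd y x) z.
rewrite oconjD onorm2D !omulDl !omulDr !omulKl.
(* With the two products abstracted, each coordinate of the polarised identity is linear in them, so
   [lra] solves for the first one. *)
move: (omul (oconj x) (omul y z)) (omul (oconj y) (omul x z)) => p q.
case: p q z => [[? ? ? ?] [? ? ? ?]] [[? ? ? ?] [? ? ? ?]] [[? ? ? ?] [? ? ? ?]].
rewrite /oadd /oscale /qadd /qscale /= => -[*].
by congr Oct; congr Quat; lra.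
Qed.
Lemma omul_altVl x y z : omul x (omul (oconj y) z) =
  oadd (oscale (2 * oip y x) z) (oscale (-1) (omul y (omul (oconj x) z))).
Proof. by have := omul_altl (oconj x) (oconj y) z; rewrite !oconjK oip_conj. Qed.

(** The composition law [onorm2M], polarised in both factors. *)
Lemma oip_mul_polar x y z w :
  oip (omul x y) (omul z w) + oip (omul z y) (omul x w) =
  2 * oip x z * oip y w.
Proof. rewrite !oip_mull omul_altl oipDr !oipZr (oipC z x); ring. Qed.

(* The middle Moufang identity (x z)(w x) = x (z w) x, combined with
   x t x = 2 <x, t^*> x - |x|^2 t^*. *)
Lemma omul_moufang x y z : omul (omul x z) (omul (oconj y) x) =
  oadd (oscale (2 * oip x (omul y (oconj z))) x)
       (oscale (- onorm2 x) (omul y (oconj z))).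
Proof.
apply: oip_inj => w; rewrite oip_mulr oconjM oconjK.
have := oip_mul_polar x z w (omul (oconj x) y).
rewrite omulVKl oipZr -oip_mull (oip_mulr x z y) (oip_mulr w z y) (oipC w) => h.
by rewrite oipDl !oipZl -[LHS](addrK (onorm2 x * oip (omul y (oconj z)) w)) h; ring.
Qed.

End Octonions.

(** * Hermitian matrices *)

(* The Hermitian matrix over the para-octonions with diagonal [ha, hb, hc] and
   entries [hx], [hy], [hz] at the places 12, 13 and 23. *)
Record herm (R : realType) := Herm
  { ha : R; hb : R; hc : R; hx : oct R; hy : oct R; hz : oct R }.

Section HermitianMatrices.
Context {R : realType}.
Implicit Types (k r : R) (s x y z : oct R) (A B : herm R).

(* Vanishing adjoint and trace one: the idempotents v v^* / |v|^2. *)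
Record rank1 A : Prop := Rank1 {
  rank1_xx : onorm2 (hx A) = ha A * hb A;
  rank1_yy : onorm2 (hy A) = ha A * hc A;
  rank1_zz : onorm2 (hz A) = hb A * hc A;
  rank1_z : omul (oconj (hx A)) (hy A) = oscale (ha A) (hz A);
  rank1_y : omul (hx A) (hz A) = oscale (hb A) (hy A);
  rank1_x : omul (hy A) (oconj (hz A)) = oscale (hc A) (hx A);
  rank1_tr : ha A + hb A + hc A = 1 }.

(** The real part of the trace of the matrix product of [A] and [B]: each off-diagonal place counts
    together with its transpose, hence the factor 2. *)
Definition trform A B : R :=
  ha A * ha B + hb A * hb B + hc A * hc B
  + 2 * (oip (hx A) (hx B) + oip (hy A) (hy B) + oip (hz A) (hz B)).

(** Simultaneous rotation of rows and columns. The places 21 and 31 move above the diagonal, which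
    explains the conjugates. *)
Definition cyc A : herm R :=
  Herm (hb A) (hc A) (ha A) (hz A) (oconj (hx A)) (oconj (hy A)).

Lemma cycK A : cyc (cyc (cyc A)) = A.
Proof. by case: A => a b c x y z; rewrite /cyc /= !oconjK. Qed.

Lemma trform_cyc A B : trform (cyc A) (cyc B) = trform A B.
Proof. rewrite /trform /= !oip_conj; ring. Qed.

Lemma rank1_cyc A : rank1 A -> rank1 (cyc A).
Proof.
case=> h1 h2 h3 h4 h5 h6 h7; split; rewrite /= ?onorm2_conj //.
- by rewrite h1 mulrC.
- by rewrite h2 mulrC.
- by rewrite -oconjM h5 oconjZ.
- by rewrite -oconjZ -h6 oconjM oconjK.
- by rewrite oconjK.
- by rewrite -h7; ring.
Qed.

(* Conjugation by the involutive matrix with rows (r, s, 0), (s^*, -r, 0) and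
   (0, 0, 1): minus the reflection along the unit vector (r, s) on the pair
   ((a - b) / 2, x). *)
Definition refl r s A : herm R :=
  let k := r * (ha A - hb A) + 2 * oip s (hx A) in
  Herm (hb A + k * r) (ha A - k * r) (hc A)
    (oadd (oscale k s) (oscale (-1) (hx A)))
    (oadd (oscale r (hy A)) (omul s (hz A)))
    (oadd (omul (oconj s) (hy A)) (oscale (- r) (hz A))).

Definition unit_pair r s : Prop := r ^+ 2 + onorm2 s = 1.

Lemma unit_pairE r s : unit_pair r s -> onorm2 s = 1 - r ^+ 2.
Proof. by move=> <-; rewrite addrC addKr. Qed.

Lemma reflK r s A : unit_pair r s -> refl r s (refl r s A) = A.
Proof.
move=> /unit_pairE hs; case: A => a b c x y z; rewrite /refl /=.
rewrite !oipDr !oipZr !omulDr !omulZr omulKl omulVKl -/(onorm2 s) hs.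
set k := r * (a - b) + _.
(* [k] is twice the component of ((a - b) / 2, x) along (r, s), and the map fixes this component. *)
have -> : r * (b + k * r - (a - k * r)) +
    2 * (k * (1 - r ^+ 2) + -1 * oip s x) = k by rewrite /k; ring.
by congr Herm; try ring; apply: oip_inj => w; rewrite !(oipDl, oipZl); ring.
Qed.

(** The map is orthogonal on the pairs ((a - b) / 2, x). On the pairs (y, z) the cross terms cancel
    because multiplications by [s] and by its conjugate are adjoint, and the remaining terms
    recombine by r^2 + |s|^2 = 1. *)
Lemma trform_refl r s A B :
  unit_pair r s -> trform (refl r s A) (refl r s B) = trform A B.
Proof.
move=> /unit_pairE hs; rewrite /trform /= !(oipDl, oipDr, oipZl, oipZr).
rewrite !(oip_mull s) !(oip_mull (oconj s)) oconjK.
rewrite omulKl omulVKl !oipZr -/(onorm2 s) hs.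
rewrite (oipC (hx A) s) (oipC (hy A) (omul s (hz B))).
rewrite (oipC (hz A) (omul (oconj s) (hy B))) !(oip_mull s).
rewrite !(oip_mull (oconj s)) oconjK (oipC (hy B)) (oip_mull s); ring.
Qed.

(** Three substitutes for associativity are used in the product equations: alternativity for
    products with a repeated factor, its polarised forms [omul_altl] and [omul_altVl] for x^* (s z)
    and x (s^* y), and the Moufang identity for (s z)(y^* s). *)
Lemma rank1_refl r s A : unit_pair r s -> rank1 A -> rank1 (refl r s A).
Proof.
move=> /unit_pairE hs; case: A => a b c x y z [/= h1 h2 h3 h4 h5 h6 h7].
(* Both cross terms between y and z are evaluated by y z^* = c x. *)
have hyz : oip y (omul s z) = c * oip s x.
  by rewrite oipC oip_mulr h6 oipZr.
have hzy : oip (omul (oconj s) y) z = c * oip s x.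
  by rewrite oip_mull oconjK.
split=> /=; set k := r * (a - b) + _.
- rewrite onorm2D !onorm2Z oipZl oipZr h1 hs /k; ring.
- rewrite onorm2D onorm2Z oipZl onorm2M hyz h2 h3 hs /k; ring.
- rewrite onorm2D onorm2Z oipZr onorm2M onorm2_conj hzy h2 h3 hs /k; ring.
- rewrite oconjD !oconjZ !omulDl !omulDr !omulZl !omulZr omulKl h4.
  rewrite (omul_altl x) h5 omulZr hs /k.
  move: (omul (oconj s) y) => p; move: (oip s x) => e.
  by apply: oip_inj => w; rewrite !(oipDl, oipZl); ring.
- rewrite !omulDl !omulDr !omulZl !omulZr omulVKl h5.
  rewrite (omul_altVl x) h4 omulZr hs /k.
  move: (omul s z) => p; move: (oip s x) => e.
  by apply: oip_inj => w; rewrite !(oipDl, oipZl); ring.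
- rewrite oconjD oconjM !oconjZ oconjK !omulDl !omulDr !omulZl !omulZr.
  rewrite omul_moufang h6 omulKr omulVKl.
  rewrite oipZr h2 h3 hs /k; move: (oip s x) => e.
  by apply: oip_inj => w; rewrite !(oipDl, oipZl); ring.
- rewrite -h7; ring.
Qed.

End HermitianMatrices.

(** * Rational maps *)

Section RationalFunctions.
Context {R : realType}.
Local Notation V := (V16 R).
Implicit Types (S : set V) (f g : V -> R) (F G : V -> V) (x v : V).

(** Formal rational expressions whose denominators have no zero on [S]. Up to equality on [S] the
    class is closed under directional derivatives, so smoothness follows by induction, without
    explicit derivatives. *)
Inductive ratfun S : (V -> R) -> Prop :=
| ratfun_cst k : ratfun S (fun=> k)
| ratfun_coord i : ratfun S (fun x => x 0 i)
| ratfunD f g : ratfun S f -> ratfun S g -> ratfun S (fun x => f x + g x)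
| ratfunM f g : ratfun S f -> ratfun S g -> ratfun S (fun x => f x * g x)
| ratfunV f : ratfun S f -> (forall x, S x -> f x != 0) ->
    ratfun S (fun x => (f x)^-1).

Lemma ratfunZ S f k : ratfun S f -> ratfun S (fun x => k * f x).
Proof. by move=> hf; apply: ratfunM hf; exact: ratfun_cst. Qed.

Lemma ratfun_ext S f g : f =1 g -> ratfun S f -> ratfun S g.
Proof. by move=> /funext ->. Qed.

Lemma ratfunN S f : ratfun S f -> ratfun S (fun x => - f x).
Proof.
by move=> hf; apply: (@ratfun_ext _ (fun x => -1 * f x)) => [x|];
  [exact: mulN1r|exact: ratfunZ].
Qed.

Lemma ratfunB S f g :
  ratfun S f -> ratfun S g -> ratfun S (fun x => f x - g x).
Proof. by move=> hf hg; apply: ratfunD hf _; exact: ratfunN. Qed.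

Lemma ratfun_sub S S' f : S' `<=` S -> ratfun S f -> ratfun S' f.
Proof.
move=> sub; elim=> {f}; [exact: ratfun_cst|exact: ratfun_coord
  |by move=> *; exact: ratfunD|by move=> *; exact: ratfunM|].
by move=> f _ hf f0; apply: ratfunV => // x /sub; exact: f0.
Qed.

Lemma ratfun_continuous S f x : ratfun S f -> S x -> {for x, continuous f}.
Proof.
move=> hf Sx; suff: f y @[y --> x] --> f x by [].
have fx : Filter (nbhs x) by exact: nbhs_filter.
elim: hf => {f} [k|i|f g _ hf _ hg|f g _ hf _ hg|f _ hf f0].
- exact: cvg_cst.
- exact: coord_continuous.
- exact: cvgD.
- exact: cvgM.
- by apply: cvgV => //; exact: f0.
Qed.

Lemma derivable_coord i x v : derivable (fun y : V => y 0 i) x v.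
Proof. by have /derivable_mxP := @derivable_id _ _ x v; apply. Qed.

Lemma derive_coord i x v : 'D_v (fun y : V => y 0 i) x = v 0 i.
Proof.
have := derive_mx (@derivable_id _ _ x v).
by rewrite derive_id => /matrixP/(_ 0 i); rewrite mxE.
Qed.

Lemma ratfun_derivable S f x v : ratfun S f -> S x -> derivable f x v.
Proof.
move=> hf Sx; elim: hf => {f} [k|i|f g _ hf _ hg|f g _ hf _ hg|f _ hf f0].
- exact: derivable_cst.
- exact: derivable_coord.
- exact: (derivableD hf hg).
- exact: (derivableM hf hg).
- by apply: derivableV => //; exact: f0.
Qed.

Lemma ratfun_derive S f v : ratfun S f ->
  exists2 g, ratfun S g & forall x, S x -> 'D_v f x = g x.
Proof.
elim=> {f} [k|i|f g hf [f' hf' ef] hg [g' hg' eg]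
  |f g hf [f' hf' ef] hg [g' hg' eg]|f hf [f' hf' ef] f0].
- by exists (fun=> 0) => [|x _]; [exact: ratfun_cst|rewrite derive_cst].
- by exists (fun=> v 0 i) => [|x _]; [exact: ratfun_cst|rewrite derive_coord].
- exists (fun x => f' x + g' x) => [|x Sx]; first exact: ratfunD.
  by rewrite (deriveD (ratfun_derivable (v:=v) hf Sx) (ratfun_derivable (v:=v) hg Sx)) ef ?eg.
- exists (fun x => f x * g' x + g x * f' x) => [|x Sx].
    by apply: ratfunD; exact: ratfunM.
  by rewrite (deriveM (ratfun_derivable (v:=v) hf Sx) (ratfun_derivable (v:=v) hg Sx)) ef ?eg.
- exists (fun x => - ((f x)^-1 * (f x)^-1 * f' x)) => [|x Sx].
    by apply/ratfunN/ratfunM => //; apply: ratfunM; exact: ratfunV.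
  rewrite (deriveV (f0 _ Sx) (ratfun_derivable (v:=v) hf Sx)) ef//.
  by rewrite -mulNr expr2 invfM.
Qed.

Definition ratrow S F := forall i, ratfun S (fun x => F x 0 i).

Lemma ratrow_continuous S F x : ratrow S F -> S x -> {for x, continuous F}.
Proof.
move=> hF Sx; suff: F y @[y --> x] --> F x by [].
have fx : Filter (nbhs x) by exact: nbhs_filter.
apply/cvgrPdist_le => /= e e0; near=> y.
rewrite /Num.Def.normr/= mx_normrE (bigmax_le _ (ltW e0))//= => -[i j] _.
rewrite !mxE/= ord1; move: j; near: y; apply: filter_forall => j.
have /cvgrPdist_le := ratfun_continuous (hF j) Sx; exact.
Unshelve. all: by end_near. Qed.

Lemma ratrow_derivable S F x v : ratrow S F -> S x -> derivable F x v.
Proof.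
move=> hF Sx; apply/derivable_mxP => i j; rewrite ord1.
exact: ratfun_derivable (hF j) Sx.
Qed.

Lemma ratrow_derive S F v : ratrow S F ->
  exists2 G, ratrow S G & forall x, S x -> 'D_v F x = G x.
Proof.
move=> hF.
have /boolp.choice [g gP] : forall i, exists g, ratfun S g /\
    forall x, S x -> 'D_v (fun y => F y 0 i) x = g x.
  by move=> i; have [g ? ?] := ratfun_derive v (hF i); exists g.
exists (fun x => \row_i g i x) => [i|x Sx].
  by apply: ratfun_ext (proj1 (gP i)) => x; rewrite mxE.
rewrite (derive_mx (ratrow_derivable (v:=v) hF Sx)); apply/matrixP => i j.
by rewrite !mxE ord1 (proj2 (gP j)).
Qed.

(** This will be applied to [loc], which is defined by choice and is known to agree with a rational
    map only on its domain. Openness makes this agreement pass to derivatives. *)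
Lemma ratrow_smooth_on S F G : open S -> ratrow S G ->
  (forall x, S x -> F x = G x) -> smooth_on S F.
Proof.
move=> oS hG FG.
have near_S (P : V -> Prop) x : S x -> (forall y, S y -> P y) ->
    \forall y \near x, P y.
  by move=> Sx SP; apply: filterS SP _; exact: open_nbhs_nbhs.
(* Agreement is kept on all of [S], not at one point, so that the next derivative can be compared in
   the induction. *)
have iterP vs : exists2 H, ratrow S H & forall x, S x -> Defs.iterD vs F x = H x.
  elim: vs => [|v vs [H hH HE]] /=; first by exists G.
  have [H' hH' HE'] := ratrow_derive v hH; exists H' => // x Sx.
  by rewrite -HE' //; apply: near_eq_derive; exact: near_S.
move=> vs x Sx; have [H hH HE] := iterP vs.
have eH : \forall y \near x, H y = Defs.iterD vs F y by apply: near_S => // y /HE.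
split=> [|v]; last exact: near_eq_derivable eH (ratrow_derivable (v:=v) hH Sx).
suff: Defs.iterD vs F y @[y --> x] --> Defs.iterD vs F x by [].
rewrite HE //; apply: cvg_trans (ratrow_continuous hH Sx).
have fx : Filter (nbhs x) by exact: nbhs_filter.
exact: near_eq_cvg eH.
Qed.

Definition ratquat S (f : V -> quat R) : Prop :=
  [/\ ratfun S (fun x => qr (f x)), ratfun S (fun x => qi (f x)), ratfun S (fun x => qj (f x))
    & ratfun S (fun x => qk (f x))].

Definition ratoct S (f : V -> oct R) : Prop :=
  ratquat S (fun x => o1 (f x)) /\ ratquat S (fun x => o2 (f x)).

Record ratherm S (f : V -> herm R) : Prop := RatHerm {
  ratherm_a : ratfun S (fun x => ha (f x)); ratherm_b : ratfun S (fun x => hb (f x));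
  ratherm_c : ratfun S (fun x => hc (f x)); ratherm_x : ratoct S (fun x => hx (f x));
  ratherm_y : ratoct S (fun x => hy (f x)); ratherm_z : ratoct S (fun x => hz (f x)) }.

Lemma ratoct_cst S s : ratoct S (fun=> s).
Proof. by split; split; exact: ratfun_cst. Qed.

Lemma ratoctD S p q : ratoct S p -> ratoct S q ->
  ratoct S (fun x => oadd (p x) (q x)).
Proof.
by move=> [[? ? ? ?] [? ? ? ?]] [[? ? ? ?] [? ? ? ?]]; split; split;
  exact: ratfunD.
Qed.

Lemma ratoctZ S k p : ratfun S k -> ratoct S p ->
  ratoct S (fun x => oscale (k x) (p x)).
Proof.
by move=> hk [[? ? ? ?] [? ? ? ?]]; split; split; exact: ratfunM hk _.
Qed.

Lemma ratoct_conj S p : ratoct S p -> ratoct S (fun x => oconj (p x)).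
Proof.
by move=> [[? ? ? ?] [? ? ? ?]]; split; split=> //; exact: ratfunN.
Qed.

Lemma ratoctM S p q : ratoct S p -> ratoct S q ->
  ratoct S (fun x => omul (p x) (q x)).
Proof.
move=> [[? ? ? ?] [? ? ? ?]] [[? ? ? ?] [? ? ? ?]].
by split; split; rewrite /=;
  repeat first [apply: ratfunB | apply: ratfunD | apply: ratfunN
               | apply: ratfunM | assumption].
Qed.

Lemma ratfun_ip S p q : ratoct S p -> ratoct S q ->
  ratfun S (fun x => oip (p x) (q x)).
Proof.
by move=> hp hq; have [[]] := ratoctM hp (ratoct_conj hq).
Qed.

Lemma ratherm_cyc S (f : V -> herm R) : ratherm S f -> ratherm S (fun x => cyc (f x)).
Proof. by case=> *; split=> //; exact: ratoct_conj. Qed.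

Lemma ratherm_refl S r s (f : V -> herm R) : ratherm S f -> ratherm S (fun x => refl r s (f x)).
Proof.
case=> fa fb fc fx fy fz.
have hk : ratfun S (fun x => r * (ha (f x) - hb (f x)) + 2 * oip s (hx (f x))).
  apply: ratfunD; first by apply/ratfunZ/ratfunB.
  by apply/ratfunZ/ratfun_ip => //; exact: ratoct_cst.
split; rewrite /=.
- by apply: ratfunD => //; apply: ratfunM => //; exact: ratfun_cst.
- by apply: ratfunB => //; apply: ratfunM => //; exact: ratfun_cst.
- by [].
- apply: ratoctD; first by apply: ratoctZ => //; exact: ratoct_cst.
  by apply: ratoctZ => //; exact: ratfun_cst.
- apply: ratoctD; first by apply: ratoctZ => //; exact: ratfun_cst.
  by apply: ratoctM => //; exact: ratoct_cst.
- apply: ratoctD; first by apply: ratoctM => //; exact: ratoct_cst.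
  by apply: ratoctZ => //; exact: ratfun_cst.
Qed.

End RationalFunctions.

(** * Transitivity on idempotents *)

Section Automorphisms.
Context {R : realType}.
Implicit Types (A B : herm R) (T : herm R -> herm R).

(** What makes [T] induce an isometry: points go to points, the trace form controls the metric, and
    rationality gives smoothness. The last field speaks of families [f], since charts parametrise
    matrices rationally. *)
Record herm_iso T : Prop := HermIso {
  herm_iso_rank1 : forall A, rank1 A -> rank1 (T A);
  herm_iso_trform : forall A B, trform (T A) (T B) = trform A B;
  herm_iso_rat : forall S f, ratherm S f -> ratherm S (fun x => T (f x)) }.

Record herm_aut T T' : Prop := HermAut {
  herm_aut_iso : herm_iso T; herm_aut_isoV : herm_iso T';
  herm_autK : cancel T T'; herm_autVK : cancel T' T }.

Lemma herm_aut_sym T T' : herm_aut T T' -> herm_aut T' T.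
Proof. by case. Qed.

Lemma herm_iso_comp T1 T2 :
  herm_iso T1 -> herm_iso T2 -> herm_iso (fun A => T1 (T2 A)).
Proof.
move=> [r1 b1 f1] [r2 b2 f2]; split=> [A /r2/r1 //|A B|S f /f2/f1 //].
by rewrite b1 b2.
Qed.

Lemma herm_aut_comp T1 T1' T2 T2' : herm_aut T1 T1' -> herm_aut T2 T2' ->
  herm_aut (fun A => T1 (T2 A)) (fun A => T2' (T1' A)).
Proof.
move=> [i1 i1' k1 k1'] [i2 i2' k2 k2']; split; try exact: herm_iso_comp.
- by move=> A; rewrite k1 k2.
- by move=> A; rewrite k2' k1'.
Qed.

Lemma herm_aut_refl r (s : oct R) :
  unit_pair r s -> herm_aut (refl r s) (refl r s).
Proof.
move=> rs; have iso : herm_iso (refl r s).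
  split=> [A|A B|S f]; first exact: rank1_refl.
    exact: trform_refl.
  exact: ratherm_refl.
by split=> // A; rewrite reflK.
Qed.

Lemma herm_aut_cyc : herm_aut (@cyc R) (fun A => cyc (cyc A)).
Proof.
have iso : herm_iso (@cyc R).
  by split=> [A|A B|S f]; [exact: rank1_cyc|exact: trform_cyc|exact: ratherm_cyc].
split=> //; first exact: herm_iso_comp.
- exact: cycK.
- exact: cycK.
Qed.

Definition ozero : oct R := Oct (qzero R) (qzero R).

Lemma oip0l (w : oct R) : oip ozero w = 0.
Proof. by rewrite oipE /= !mul0r !subr0 !addr0. Qed.

(* [refl r s] with (r, s) proportional to (b, - x) kills the first row, by the
   rank one equations |x|^2 = a b and x z = b y. *)
Lemma refl_kill A : rank1 A -> 0 < hb A -> 0 < ha A + hb A ->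
  exists r s, unit_pair r s /\ exists z,
    refl r s A = Herm 0 (ha A + hb A) (hc A) ozero ozero z /\
    (hy A = ozero -> hz A = ozero -> z = ozero).
Proof.
move=> [h1 h2 h3 h4 h5 h6 h7] b0 ab0.
case: A h1 h2 h3 h4 h5 h6 h7 b0 ab0 => a b c x y z /= h1 h2 h3 h4 h5 h6 h7 b0 ab0.
have bn : b != 0 by rewrite gt_eqF.
have abn : a + b != 0 by rewrite gt_eqF.
pose r := Num.sqrt (b / (a + b)).
have r2 : r ^+ 2 = b / (a + b) by rewrite sqr_sqrtr // ltW // divr_gt0.
exists r, (oscale (- (r / b)) x); split.
  rewrite /unit_pair onorm2Z h1 sqrrN expr_div_n r2.
  by field; rewrite bn abn.
exists (oadd (omul (oconj (oscale (- (r / b)) x)) y) (oscale (- r) z)).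
have kE : r * (a - b) + 2 * oip (oscale (- (r / b)) x) x = - (r * (a + b)).
  by rewrite oipZl -/(onorm2 x) h1; field.
have rr : r * (a + b) * r = b.
  by rewrite mulrAC -expr2 r2 divfK.
split; last first.
  move=> -> ->; apply: oip_inj => w.
  by rewrite oipDl oip_mull oipZl !oip0l mulr0 addr0.
rewrite /refl /= kE; congr Herm.
- by rewrite mulNr rr subrr.
- by rewrite mulNr rr opprK.
- apply: oip_inj => w; rewrite oipDl !oipZl oip0l.
  rewrite mulrA mulrNN mulrA rr divff //; ring.
- apply: oip_inj => w; rewrite oipDl omulZl h5 !oipZl oip0l.
  by field.
Qed.

Lemma unit_pair01 : unit_pair 0 (oone R).
Proof. by rewrite /unit_pair onorm2_1 expr0n add0r. Qed.

(** When [hb A] is not positive, [refl 0 (oone R)] first exchanges the two leading diagonal entries.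
    The last clause ensures that a second use does not spoil the zeros made by the first. *)
Lemma herm_aut_kill A : rank1 A -> 0 < ha A + hb A ->
  exists T T', herm_aut T T' /\ exists z,
    T A = Herm 0 (ha A + hb A) (hc A) ozero ozero z /\
    (hy A = ozero -> hz A = ozero -> z = ozero).
Proof.
move=> rA ab0; case: (ltrP 0 (hb A)) => [b0|b0].
  have [r [s [rs [z hz]]]] := refl_kill rA b0 ab0.
  by exists (refl r s), (refl r s); split; [exact: herm_aut_refl|exists z].
pose B := refl 0 (oone R) A.
have rB : rank1 B by exact: rank1_refl unit_pair01 rA.
have aB : ha B = hb A by rewrite /B /=; ring.
have bB : hb B = ha A by rewrite /B /=; ring.
have b0' : 0 < hb B by rewrite bB; lra.
have ab0' : 0 < ha B + hb B by rewrite aB bB addrC.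
have [r [s [rs [z [eqz hz]]]]] := refl_kill rB b0' ab0'.
exists (fun C => refl r s (refl 0 (oone R) C)).
exists (fun C => refl 0 (oone R) (refl r s C)); split.
  by apply: herm_aut_comp; apply: herm_aut_refl => //; exact: unit_pair01.
exists z; split; first by rewrite -/B eqz aB bB addrC.
move=> y0 z0; apply: hz; rewrite /B /= y0 z0; apply: oip_inj => w;
  by rewrite oipDl !(oip_mull, oipZl) !oip0l mulr0 addr0.
Qed.

Lemma herm_aut_normal_form A : rank1 A -> exists T T', herm_aut T T' /\
  T A = Herm 0 1 0 ozero ozero ozero.
Proof.
(* The first use clears row one, which [cyc] makes the third row. The second use then collects the
   whole trace in one diagonal entry. *)
have main B : rank1 B -> 0 < ha B + hb B -> exists T T', herm_aut T T' /\
    T B = Herm 0 1 0 ozero ozero ozero.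
  move=> rB abB; have [T [T' [aT [z [TB _]]]]] := herm_aut_kill rB abB.
  have rC : rank1 (cyc (T B)) by apply/rank1_cyc/(herm_iso_rank1 (herm_aut_iso aT)).
  have c0 : oconj ozero = ozero by rewrite /oconj /qconj /qopp /= oppr0.
  have abC : 0 < ha (cyc (T B)) + hb (cyc (T B)).
    by rewrite TB /= (rank1_tr rB).
  have [U [U' [aU [w [UC hw]]]]] := herm_aut_kill rC abC.
  exists (fun D => U (cyc (T D))), (fun D => T' (cyc (cyc (U' D)))); split.
    exact: herm_aut_comp aU (herm_aut_comp herm_aut_cyc aT).
  by rewrite UC TB /= (rank1_tr rB) hw // TB /= c0.
(* The three sums of two diagonal entries add up to 2, so one of them is positive; rotating the
   indices makes it the first. *)
move=> rA.
have [ab|ab] := ltrP 0 (ha A + hb A); first exact: main.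
have cycA B : rank1 (cyc B) -> (0 < hb B + hc B) ->
    exists T T', herm_aut T T' /\ T B = Herm 0 1 0 ozero ozero ozero.
  move=> rB bcB; have [T [T' [aT TB]]] := main _ rB bcB.
  exists (fun D => T (cyc D)), (fun D => cyc (cyc (T' D))); split=> //.
  exact: herm_aut_comp aT herm_aut_cyc.
have [bc|bc] := ltrP 0 (hb A + hc A); first exact: (cycA A (rank1_cyc rA)).
have ca : 0 < hc A + ha A by have := rank1_tr rA; lra.
have [T [T' [aT TB]]] := cycA (cyc A) (rank1_cyc (rank1_cyc rA)) ca.
exists (fun D => T (cyc D)), (fun D => cyc (cyc (T' D))); split=> //.
exact: herm_aut_comp aT herm_aut_cyc.
Qed.

Lemma herm_aut_transitive A B :
  rank1 A -> rank1 B -> exists T T', herm_aut T T' /\ T A = B.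
Proof.
move=> /herm_aut_normal_form[T [T' [aT TA]]] /herm_aut_normal_form[U [U' [aU UB]]].
exists (fun C => U' (T C)), (fun C => T' (U C)); split.
  exact: herm_aut_comp (herm_aut_sym aU) aT.
by rewrite TA -UB (herm_autK aU).
Qed.

End Automorphisms.

(** * Points and charts *)

Section ProjectivePlane.
Context {R : realType}.
Implicit Types (A B : herm R) (s t : trip R) (x y : V16 R) (i j : 'I_3).

Definition tnorm t : R :=
  let '(p, q, r) := t in onorm2 p + onorm2 q + onorm2 r.

Definition pmat t : herm R :=
  let d := (tnorm t)^-1 in
  let '(p, q, r) := t in
  Herm (d * onorm2 p) (d * onorm2 q) (d * onorm2 r)
    (oscale d (omul p (oconj q))) (oscale d (omul p (oconj r)))
    (oscale d (omul q (oconj r))).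

Definition tcyc t : trip R := let '(p, q, r) := t in (q, r, p).

Lemma tnorm_cyc t : tnorm (tcyc t) = tnorm t.
Proof. by case: t => [[p q] r] /=; rewrite addrC addrA. Qed.

Lemma pmat_cyc t : pmat (tcyc t) = cyc (pmat t).
Proof.
move: (tnorm_cyc t); case: t => [[p q] r]; rewrite /pmat => ->.
by rewrite /cyc /= !oconjZ !oconjM !oconjK.
Qed.

Lemma inUP t : inU t <-> 0 < tnorm t /\
  let '(p, q, r) := t in [\/ p = oone R, q = oone R | r = oone R].
Proof.
case: t => [[p q] r] /=; split.
  move=> [[-> h]|[[-> h]|[-> h]]]; rewrite onorm2_1; split=> //.
  - exact: Or31.
  - exact: Or32.
  - exact: Or33.
move=> [h [e|e|e]]; move: h; rewrite e onorm2_1.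
- by left.
- by right; left.
- by right; right.
Qed.

Lemma inU_cyc t : inU (tcyc t) <-> inU t.
Proof.
rewrite !inUP tnorm_cyc; case: t => [[p q] r] /=.
split=> -[? [?|?|?]]; split=> //;
  by [exact: Or31|exact: Or32|exact: Or33].
Qed.

Lemma sim_cyc t s : sim (tcyc t) (tcyc s) <-> sim t s.
Proof.
case: t s => [[a b] c] [[d e] f] /=.
by split=> -[l [? [? [? ?]]]]; exists l.
Qed.

(** Reduces statements compatible with rotation to triples starting with one. Only two octonions
    remain there, so that alternativity does the work of associativity. *)
Lemma inU_ind (P : trip R -> Prop) :
  (forall q r, inU (oone R, q, r) -> P (oone R, q, r)) ->
  (forall t, P (tcyc t) -> P t) -> forall t, inU t -> P t.
Proof.
move=> P1 Pc t tU; case: t tU => [[p q] r] tU.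
have [_ [e|e|e]] := (inUP _).1 tU; subst; first exact: P1.
  by apply: (Pc (p, oone R, r)); apply: P1; exact/(inU_cyc (p, oone R, r)).
apply: (Pc (p, q, oone R)); apply: (Pc (q, oone R, p)); apply: P1.
by apply/(inU_cyc (q, oone R, p))/(inU_cyc (p, q, oone R)).
Qed.

Lemma rank1_cycV A : rank1 (cyc A) -> rank1 A.
Proof. by move=> /rank1_cyc/rank1_cyc; rewrite cycK. Qed.

Lemma rank1_pmat t : inU t -> rank1 (pmat t).
Proof.
move: t; apply: inU_ind => [q r|t]; last by rewrite pmat_cyc => /rank1_cycV.
move=> /inUP[+ _]; rewrite /pmat; set n := tnorm _ => n0; set d := n^-1.
have dn : d * (1 + onorm2 q + onorm2 r) = 1.
  have nE : n = 1 + onorm2 q + onorm2 r by rewrite /n /= onorm2_1.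
  by rewrite /d -nE mulVf // gt_eqF.
rewrite onorm2_1 mulr1 !omul1l; split=> /=.
- by rewrite onorm2Z onorm2_conj; ring.
- by rewrite onorm2Z onorm2_conj; ring.
- by rewrite onorm2Z onorm2M onorm2_conj; ring.
- by rewrite oconjZ oconjK omulZl omulZr.
- rewrite omulZl omulZr omulKl !oscaleA; congr oscale; ring.
- rewrite oconjZ oconjM oconjK omulZl omulZr omulKl !oscaleA; congr oscale; ring.
- by rewrite -dn; ring.
Qed.

Lemma oscale_inj k : k != 0 -> injective (@oscale R k).
Proof.
move=> k0 x y /(congr1 (oscale k^-1)).
by rewrite !oscaleA mulVf // !oscale1.
Qed.

(** The equation [rank1_z] recovers the entry 23 after division by [ha]. *)
Lemma rank1_ext A B : rank1 A -> rank1 B -> ha A != 0 ->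
  ha A = ha B -> hb A = hb B -> hc A = hc B -> hx A = hx B -> hy A = hy B ->
  A = B.
Proof.
move=> /rank1_z zA /rank1_z zB.
case: A B zA zB => a b c x y z [a' b' c' x' y' z'] /= zA zB a0 ea eb ec ex ey.
subst; congr Herm; apply: (oscale_inj a0).
by rewrite -zA -zB.
Qed.

(** Equality of matrices is transitive, hence so is [sim] on [U], although the product is not
    associative. After rotation [s] starts with one, so the multiplier must be the first entry [p]
    of [t]; the first rows of the matrices then determine the other two entries. *)
Lemma sim_pmatP t s : inU t -> inU s -> (sim t s <-> pmat t = pmat s).
Proof.
move=> + sU; move: s sU t; apply: (inU_ind (P := fun s => forall t,
    inU t -> (sim t s <-> pmat t = pmat s))) => [e f sU|s IH t tU]; last first.
  rewrite -sim_cyc IH ?inU_cyc // !pmat_cyc; split=> [|->//].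
  by move=> /(congr1 (fun A => cyc (cyc A))); rewrite !cycK.
move=> [[p q] r] tU; have [t0 _] := (inUP _).1 tU; have [s0 _] := (inUP _).1 sU.
have rs := rank1_pmat sU; have rt := rank1_pmat tU.
split.
  move=> [l [l0 [pl [ql rl]]]]; move: pl t0 tU rt; rewrite omul1l => pl; subst.
  rewrite /= !onorm2M => t0 tU rt.
  have nE : onorm2 l + onorm2 e * onorm2 l + onorm2 f * onorm2 l =
    onorm2 l * (onorm2 (oone R) + onorm2 e + onorm2 f).
    by rewrite onorm2_1; ring.
  have ln : onorm2 l != 0 by rewrite gt_eqF.
  have sn : onorm2 (oone R) + onorm2 e + onorm2 f != 0 by rewrite gt_eqF.
  apply: rank1_ext; rewrite //= ?nE.
  - by rewrite mulf_neq0 // invr_neq0 // mulf_neq0.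
  - by rewrite onorm2_1 in sn *; field; rewrite sn.
  - by rewrite onorm2_1 in sn *; field; rewrite sn.
  - by rewrite onorm2_1 in sn *; field; rewrite sn.
  - rewrite oconjM omulVKl omul1l !oscaleA; congr oscale.
    by rewrite onorm2_1 in sn *; field; rewrite sn.
  - rewrite oconjM omulVKl omul1l !oscaleA; congr oscale.
    by rewrite onorm2_1 in sn *; field; rewrite sn.
rewrite /pmat; move: (tnorm (p, q, r)) t0 => n n0.
move: (tnorm (oone R, e, f)) s0 => m m0.
rewrite onorm2_1 !omul1l mulr1 => eH.
have ea := congr1 (@ha R) eH; have ex := congr1 (@hx R) eH.
have ey := congr1 (@hy R) eH; rewrite /= in ea ex ey.
have nn : n != 0 by rewrite gt_eqF.
have p0 : 0 < onorm2 p.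
  have : 0 < n * m^-1 by rewrite mulr_gt0 // invr_gt0.
  by rewrite -ea mulrA divff // mul1r.
have key w w' : oscale n^-1 (omul p (oconj w)) = oscale m^-1 (oconj w') ->
    w = omul w' p.
  move=> /(congr1 (fun o => omul (oconj o) p)).
  rewrite !oconjZ oconjM !oconjK !omulZl omulVKr oscaleA ea => h.
  by apply: oscale_inj h; rewrite invr_neq0 // gt_eqF.
exists p; split=> //; split; first by rewrite omul1l.
by split; [exact: key ex|exact: key ey].
Qed.

(** Each generating step preserves the matrix, hence so does a chain of steps; conversely, triples
    with equal matrices are one step apart. *)
Lemma eqclassE t : inU t -> eqclass t = [set s | inU s /\ pmat s = pmat t].
Proof.
move=> tU; apply/seteqP; split=> s /= [sU st]; split=> //; last first.
  by apply: Relation_Operators.rst_step; split=> //; split=> //; apply/sim_pmatP.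
elim: st => {s sU} [s u [sU [uU /sim_pmatP]]||s u _ ->|s u v _ -> _ ->] //.
exact.
Qed.

Definition cnorm x : R := 1 + onorm2 (uOf x) + onorm2 (vOf x).

Lemma tnorm_emb i x : tnorm (emb i x) = cnorm x.
Proof.
rewrite /emb /cnorm; case: i => [[|[|m]] hi] /=; rewrite onorm2_1; ring.
Qed.

Lemma chart_domP i x : chart_dom i x <-> 0 < cnorm x.
Proof.
rewrite /chart_dom /= inUP tnorm_emb /emb.
case: i => [[|[|m]] hi] /=; split=> [[]//|h]; split=> //.
- exact: Or31.
- exact: Or32.
- exact: Or33.
Qed.

Definition row_of (u v : oct R) : V16 R := \row_k nth 0
  [:: qr (o1 u); qi (o1 u); qj (o1 u); qk (o1 u);
      qr (o2 u); qi (o2 u); qj (o2 u); qk (o2 u);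
      qr (o1 v); qi (o1 v); qj (o1 v); qk (o1 v);
      qr (o2 v); qi (o2 v); qj (o2 v); qk (o2 v)] k.

Lemma uOf_row u v : uOf (row_of u v) = u.
Proof.
rewrite /uOf /oct_of_row !mxE !inordK //=.
by case: u => [[? ? ? ?] [? ? ? ?]].
Qed.

Lemma vOf_row u v : vOf (row_of u v) = v.
Proof.
rewrite /vOf /oct_of_row !mxE !inordK //=.
by case: v => [[? ? ? ?] [? ? ? ?]].
Qed.

Lemma row_ofK x : row_of (uOf x) (vOf x) = x.
Proof.
apply/rowP => -[k kn]; rewrite !mxE /=.
do 16! [case: k kn => [|k] kn /=; first by congr (x _ _); apply: val_inj;
  rewrite /= inordK].
by [].
Qed.

Definition hdiag j A : R :=
  match val j with 0%N => ha A | 1%N => hb A | _ => hc A end.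

(** Column [j] divided by its diagonal entry: when v_j = 1, column [j] of v v^* / |v|^2 is v /
    |v|^2. *)
Definition crd j A : V16 R :=
  let d := (hdiag j A)^-1 in
  match val j with
  | 0%N => row_of (oscale d (oconj (hx A))) (oscale d (oconj (hy A)))
  | 1%N => row_of (oscale d (hx A)) (oscale d (oconj (hz A)))
  | _ => row_of (oscale d (hy A)) (oscale d (hz A))
  end.

Lemma hdiag_emb j y : hdiag j (pmat (emb j y)) = (cnorm y)^-1.
Proof.
rewrite -(tnorm_emb j) /pmat; move: (tnorm _) => n; rewrite /emb /hdiag.
by case: j => [[|[|m]] hj] /=; rewrite onorm2_1 mulr1.
Qed.

Lemma crd_emb j y : 0 < cnorm y -> crd j (pmat (emb j y)) = y.
Proof.
move=> y0; rewrite /crd hdiag_emb invrK -[RHS]row_ofK.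
have yn : cnorm y != 0 by rewrite gt_eqF.
rewrite /pmat tnorm_emb /emb.
by case: j => [[|[|m]] hj] /=; rewrite ?oconjZ ?omul1l ?oconj1 ?omul1r ?oconjK
  !oscaleA divff // !oscale1.
Qed.

Lemma emb_crd j A : rank1 A -> 0 < hdiag j A ->
  0 < cnorm (crd j A) /\ pmat (emb j (crd j A)) = A.
Proof.
case: A => a b c x y z [/= h1 h2 h3 h4 h5 h6 h7] d0.
have dn : hdiag j (Herm a b c x y z) != 0 by rewrite gt_eqF.
(* By the rank one equations, 1 + |u|^2 + |v|^2 is the trace divided by the diagonal entry of the
   chart, and the trace is one. *)
have nE : cnorm (crd j (Herm a b c x y z)) = (hdiag j (Herm a b c x y z))^-1.
  move: dn; rewrite /cnorm /crd /hdiag.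
  case: j {d0} => [[|[|m]] hj] /= dn; rewrite uOf_row vOf_row !onorm2Z
    ?onorm2_conj ?h1 ?h2 ?h3 -[RHS]mul1r -[1 in RHS]h7; by field.
split; first by rewrite nE invr_gt0.
rewrite /pmat tnorm_emb nE invrK; move: dn; rewrite /emb /crd /hdiag.
case: j {d0 nE} => [[|[|m]] hj] /= dn; rewrite uOf_row vOf_row.
all: rewrite !(omulZl, omulZr, oconjZ, oconjK, omul1l, oconj1, omul1r) ?h4 ?h5 ?h6.
all: rewrite !onorm2Z ?onorm2_conj ?onorm2_1 ?h1 ?h2 ?h3 !oscaleA.
all: congr Herm; try (by field).
all: by rewrite -[RHS]oscale1; congr oscale; field.
Qed.

Lemma rank1_hdiag A : rank1 A -> exists j, 0 < hdiag j A.
Proof.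
move=> /rank1_tr trA.
have [a0|a0] := ltrP 0 (ha A); first by exists (@Ordinal 3 0 isT).
have [b0|b0] := ltrP 0 (hb A); first by exists (@Ordinal 3 1 isT).
by exists (@Ordinal 3 2 isT); rewrite /hdiag /=; lra.
Qed.

Lemma pmat_surj A : rank1 A -> exists2 t, inU t & pmat t = A.
Proof.
move=> rA; have [j jA] := rank1_hdiag rA; have [n0 eA] := emb_crd rA jA.
by exists (emb j (crd j A)) => //; exact/(chart_domP j).
Qed.

(** [ds2] divides by D(x)^2, where D is [cnorm]; the factor D(x) / D(y) corrects this to the
    symmetric D(x) D(y). *)
Lemma trform_pmat_emb i x y : 0 < cnorm x -> 0 < cnorm y ->
  trform (pmat (emb i x)) (pmat (emb i y)) =
  1 - ds2 x (y - x) * (cnorm x / cnorm y).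
Proof.
move=> x0 y0.
have xn : cnorm x != 0 by rewrite gt_eqF.
have yn : cnorm y != 0 by rewrite gt_eqF.
have uB : uOf (y - x) = oadd (uOf y) (oscale (-1) (uOf x)).
  by rewrite /uOf /oct_of_row !mxE /oadd /oscale /qadd /qscale /= !mulN1r.
have vB : vOf (y - x) = oadd (vOf y) (oscale (-1) (vOf x)).
  by rewrite /vOf /oct_of_row !mxE /oadd /oscale /qadd /qscale /= !mulN1r.
rewrite /ds2 uB vB.
set u := uOf x; set v := vOf x; set u' := uOf y; set v' := vOf y.
set du := oadd _ _; set dv := oadd _ _.
have -> : ore (omul (omul u (oconj v)) (omul dv (oconj du))) =
    oip (omul u (oconj v)) (omul du (oconj dv)).
  by rewrite /oip oconjM oconjK.
(* Alternativity collapses every term of the expanded product du dv^* except the one pairing u v^*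
   with u' v'^*. *)
have e1 w : oip (omul u (oconj v)) (omul w (oconj v)) = onorm2 v * oip u w.
  by rewrite oip_mulr oconjK omulVKr oipZr.
have e2 w : oip (omul u (oconj v)) (omul u (oconj w)) = onorm2 u * oip v w.
  by rewrite oip_mull omulKl oipZr oip_conj.
have e3 : oip (omul u (oconj v)) (omul du (oconj dv)) =
    oip (omul u (oconj v)) (omul u' (oconj v')) - onorm2 v * oip u u'
    - onorm2 u * oip v v' + onorm2 u * onorm2 v.
  rewrite /du /dv oconjD oconjZ !omulDl !omulDr !omulZl !omulZr.
  by rewrite !(oipDr, oipZr) !e1 !e2 -/(onorm2 v) -/(onorm2 u); ring.
have e4 : onorm2 du = onorm2 u' - 2 * oip u u' + onorm2 u.
  by rewrite onorm2D onorm2Z oipZr (oipC u'); ring.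
have e5 : onorm2 dv = onorm2 v' - 2 * oip v v' + onorm2 v.
  by rewrite onorm2D onorm2Z oipZr (oipC v'); ring.
(* In each chart two off-diagonal entries contain the coordinate one and the third is u v^*; hence
   the same formula in all charts. *)
have e6 w w' : oip (omul w (oconj (oone R))) (omul w' (oconj (oone R))) = oip w w'.
  by rewrite oconj1 !omul1r.
have e7 w w' : oip (omul (oone R) (oconj w)) (omul (oone R) (oconj w')) = oip w w'.
  by rewrite !omul1l oip_conj.
rewrite e3 e4 e5 /trform /pmat !tnorm_emb /emb.
have cE z : cnorm z = 1 + onorm2 (uOf z) + onorm2 (vOf z) by [].
by case: i => [[|[|m]] hi] /=; rewrite !(oipZl, oipZr) ?e6 ?e7 !onorm2_1;
  move: xn yn; rewrite !cE -/u -/v -/u' -/v' => xn yn; field; rewrite xn yn.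
Qed.

End ProjectivePlane.

(** * Isometries *)

Section Isometries.
Context {R : realType}.
Implicit Types (A B : herm R) (T : herm R -> herm R) (s t : trip R).
Implicit Types (x y : V16 R) (i j : 'I_3) (p : set (trip R)).

Definition act T p : set (trip R) :=
  [set t | inU t /\ exists2 s, p s & pmat t = T (pmat s)].

Definition fiber A : set (trip R) := [set t | inU t /\ pmat t = A].

Lemma act_eqclass T t : inU t -> act T (eqclass t) = fiber (T (pmat t)).
Proof.
move=> tU; rewrite eqclassE //; apply/seteqP; split=> s /=.
  by move=> [sU [u [_ uE] sE]]; split; rewrite // sE uE.
by move=> [sU sE]; split=> //; exists t.
Qed.

Lemma act_point T p : herm_iso T -> is_point p -> is_point (act T p).
Proof.
move=> [rT _ _] [t [tU ->]]; rewrite act_eqclass //.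
have [s sU sE] := pmat_surj (rT _ (rank1_pmat tU)).
by exists s; split=> //; rewrite eqclassE // sE.
Qed.

Lemma actK T T' p : herm_aut T T' -> is_point p -> act T' (act T p) = p.
Proof.
move=> [[rT _ _] _ TK _] [t [tU ->]]; rewrite act_eqclass //.
have [s sU sE] := pmat_surj (rT _ (rank1_pmat tU)).
by rewrite -sE -[fiber _]eqclassE // act_eqclass // sE TK eqclassE.
Qed.

Lemma in_chart_fiber j A : rank1 A -> in_chart j (fiber A) <-> 0 < hdiag j A.
Proof.
move=> rA; split=> [[x [/(chart_domP j) xU <-]]|/(emb_crd rA)[n0 eA]].
  by rewrite hdiag_emb invr_gt0.
by exists (crd j A); split=> //; exact/(chart_domP j).
Qed.

Lemma phi_fiber j A : rank1 A -> 0 < hdiag j A -> phi j (fiber A) = crd j A.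
Proof.
move=> rA jA; rewrite /phi; have [y fy] := (in_chart_fiber j rA).2 jA.
have /(xgetPex 0) : exists y, [set x | fiber A (emb j x)] y by exists y.
move: (xget _ _) => z [/(chart_domP j) z0 <-].
by rewrite crd_emb.
Qed.

Definition actdom T i j : set (V16 R) :=
  [set x | 0 < cnorm x /\ 0 < hdiag j (T (pmat (emb i x)))].

Lemma locdom_act T i j : herm_iso T -> locdom (act T) i j = actdom T i j.
Proof.
move=> [rT _ _]; apply/seteqP; split=> x [xU] /=; last first.
  move=> h; have xD : chart_dom i x by apply/chart_domP.
  split=> //; rewrite /psi act_eqclass //.
  by apply/in_chart_fiber => //; exact/rT/rank1_pmat.
rewrite /psi act_eqclass // => /in_chart_fiber h.
split; first exact/(chart_domP i).
by apply: h; exact/rT/rank1_pmat.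
Qed.

Lemma loc_act T i j x : herm_iso T -> actdom T i j x ->
  loc (act T) i j x = crd j (T (pmat (emb i x))).
Proof.
move=> [rT _ _] [x0 xj]; have xU : inU (emb i x) by exact/(chart_domP i).
rewrite /loc /psi act_eqclass // phi_fiber //.
exact/rT/rank1_pmat.
Qed.

Lemma ratoct_uOf (S : set (V16 R)) : ratoct S (@uOf R).
Proof. by split; split; exact: ratfun_coord. Qed.

Lemma ratoct_vOf (S : set (V16 R)) : ratoct S (@vOf R).
Proof. by split; split; exact: ratfun_coord. Qed.

Lemma ratfun_cnorm (S : set (V16 R)) : ratfun S (@cnorm R).
Proof.
apply: ratfunD; first apply: ratfunD; first exact: ratfun_cst.
  by apply: ratfun_ip; exact: ratoct_uOf.
by apply: ratfun_ip; exact: ratoct_vOf.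
Qed.

Lemma ratherm_pmat_emb i :
  ratherm [set x : V16 R | 0 < cnorm x] (fun x => pmat (emb i x)).
Proof.
set S := [set x | _].
have hd : ratfun S (fun x => (cnorm x)^-1).
  by apply: ratfunV => [|x x0]; [exact: ratfun_cnorm|rewrite gt_eqF].
have hpmat (f g h : V16 R -> oct R) : ratoct S f -> ratoct S g -> ratoct S h ->
    (forall x, tnorm (f x, g x, h x) = cnorm x) ->
    ratherm S (fun x => pmat (f x, g x, h x)).
  move=> hf hg hh e; rewrite /pmat; under eq_fun do rewrite e.
  by split=> /=; first [apply: ratfunM => //; exact: ratfun_ip
    | apply: ratoctZ => //; apply: ratoctM => //; exact: ratoct_conj].
have h1 := ratoct_cst S (oone R).
have hu := ratoct_uOf S; have hv := ratoct_vOf S.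
case: i => [[|[|m]] hi].
- exact: hpmat h1 hu hv (tnorm_emb (Ordinal hi)).
- exact: hpmat hu h1 hv (tnorm_emb (Ordinal hi)).
- exact: hpmat hu hv h1 (tnorm_emb (Ordinal hi)).
Qed.

Lemma ratfun_hdiag S j (f : V16 R -> herm R) :
  ratherm S f -> ratfun S (fun x => hdiag j (f x)).
Proof. by case; rewrite /hdiag; case: j => [[|[|m]] hj]. Qed.

Lemma ratrow_row_of S (f g : V16 R -> oct R) : ratoct S f -> ratoct S g ->
  ratrow S (fun x => row_of (f x) (g x)).
Proof.
move=> [[? ? ? ?] [? ? ? ?]] [[? ? ? ?] [? ? ? ?]] [k kn].
apply: (@ratfun_ext _ _ (fun x => nth 0 _ k)).
  by move=> x; rewrite mxE /=; reflexivity.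
by do 16! [case: k kn => [|k] kn //=].
Qed.

Lemma ratrow_crd S j (f : V16 R -> herm R) : ratherm S f ->
  (forall x, S x -> 0 < hdiag j (f x)) -> ratrow S (fun x => crd j (f x)).
Proof.
move=> hf j0; have hd : ratfun S (fun x => (hdiag j (f x))^-1).
  apply: ratfunV => [|x /j0 h]; first exact: ratfun_hdiag.
  by rewrite gt_eqF.
case: hf => _ _ _ fx fy fz; rewrite /crd.
case: (val j) => [|[|m]]; apply: ratrow_row_of;
  by apply: ratoctZ => //; exact: ratoct_conj.
Qed.

Lemma open_ratfun_gt0 (S : set (V16 R)) (f : V16 R -> R) :
  open S -> ratfun S f -> open [set x | S x /\ 0 < f x].
Proof.
move=> oS hf; rewrite openE => x [Sx fx0].
have fx : Filter (nbhs x) by exact: nbhs_filter.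
apply: filterI; first exact: open_nbhs_nbhs.
have fc : f y @[y --> x] --> f x := ratfun_continuous hf Sx.
exact: cvgr_gt fc _ fx0.
Qed.

Lemma open_actdom T i j : herm_iso T -> open (actdom T i j).
Proof.
move=> [_ _ fT]; apply: open_ratfun_gt0; last first.
  exact/ratfun_hdiag/fT/ratherm_pmat_emb.
have := open_ratfun_gt0 openT (@ratfun_cnorm setT).
by rewrite (_ : [set x | _] = [set x | 0 < cnorm x]) //; apply/seteqP; split=> x // [].
Qed.

Lemma ratherm_sub (S S' : set (V16 R)) f : S' `<=` S -> ratherm S f -> ratherm S' f.
Proof.
move=> sub [? ? ? [[? ? ? ?] [? ? ? ?]] [[? ? ? ?] [? ? ? ?]] [[? ? ? ?] [? ? ? ?]]].
by split; [..|split; split|split; split|split; split]; exact: ratfun_sub sub _.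
Qed.

Lemma smooth_act T : herm_iso T -> smooth_map (act T).
Proof.
move=> iT; split=> [p|i j]; first exact: act_point.
rewrite locdom_act //; split; first exact: open_actdom.
have hG : ratrow (actdom T i j) (fun x => crd j (T (pmat (emb i x)))).
  apply: ratrow_crd => [|x []//]; case: (iT) => _ _; apply.
  by apply: ratherm_sub (ratherm_pmat_emb i) => x [].
apply: (ratrow_smooth_on (open_actdom iT) hG) => x.
exact: loc_act.
Qed.

Lemma ds2Z k x xi : ds2 x (k *: xi) = k ^+ 2 * ds2 x xi.
Proof.
have uZ : uOf (k *: xi) = oscale k (uOf xi).
  by rewrite /uOf /oct_of_row !mxE.
have vZ : vOf (k *: xi) = oscale k (vOf xi).
  by rewrite /vOf /oct_of_row !mxE.
rewrite /ds2 uZ vZ !onorm2Z oconjZ !omulZl !omulZr.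
have oreZ r (w : oct R) : ore (oscale r w) = r * ore w by [].
by rewrite !oreZ; ring.
Qed.

(** Rationality in the tangent vector at a fixed base point; it provides the continuity needed for
    the limit of difference quotients. *)
Lemma ratfun_ds2 (S : set (V16 R)) x : ratfun S (ds2 x).
Proof.
have hu := ratoct_uOf S; have hv := ratoct_vOf S.
rewrite /ds2; apply: ratfunM; last exact: ratfun_cst.
apply: ratfunB; first apply: ratfunD.
- by apply: ratfunM; [exact: ratfun_ip|exact: ratfun_cst].
- by apply: ratfunM; [exact: ratfun_ip|exact: ratfun_cst].
apply: ratfunZ.
have [[+ _ _ _] _] := ratoctM (ratoct_cst S (omul (uOf x) (oconj (vOf x))))
  (ratoctM hv (ratoct_conj hu)).
by apply.
Qed.

(* By [trform_pmat_emb] the two-point invariant [trform] determines [ds2] at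
   finite distance. *)
Lemma ds2_act T i j x y : herm_iso T -> actdom T i j x -> actdom T i j y ->
  let f := loc (act T) i j in
  ds2 (f x) (f y - f x) * (cnorm (f x) / cnorm (f y)) =
  ds2 x (y - x) * (cnorm x / cnorm y).
Proof.
move=> iT xD yD /=; rewrite !loc_act //.
have [rT bT _] := iT; case: xD yD => x0 xj [y0 yj].
have rx : rank1 (T (pmat (emb i x))) by apply/rT/rank1_pmat/(chart_domP i).
have ry : rank1 (T (pmat (emb i y))) by apply/rT/rank1_pmat/(chart_domP i).
have [fx0 ex] := emb_crd rx xj; have [fy0 ey] := emb_crd ry yj.
have := trform_pmat_emb j fx0 fy0; rewrite ex ey bT trform_pmat_emb //.
by move=> /addrI/oppr_inj ->.
Qed.

Lemma preserves_metric_act T : herm_iso T -> preserves_metric (act T).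
Proof.
move=> iT i j x; rewrite locdom_act // => xD xi.
set f := loc (act T) i j.
(* The empty list of directions gives continuity and derivability of [f] itself. *)
have [] := (smooth_act iT).2 i j; rewrite locdom_act // => oD /(_ [::] x xD)[fc fd].
have {fc} fc : f y @[y --> x] --> f x := fc.
have {fd} fd : h^-1 *: (f (h *: xi + x) - f x) @[h --> 0^'] --> 'D_xi f x := fd xi.
have lc : (h *: xi + x) @[h --> (0 : R)] --> x.
  have : (h *: xi + x) @[h --> (0 : R)] --> 0 *: xi + x.
    by apply: cvgD; [exact: scalel_continuous|exact: cvg_cst].
  by rewrite scale0r add0r.
have lcw : (h *: xi + x) @[h --> (0 : R)^'] --> x by exact: cvg_within_filter lc.
have cc z : cnorm y @[y --> z] --> cnorm z :=
  ratfun_continuous (@ratfun_cnorm setT) I.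
have [x0 _] := xD.
have fx0 : 0 < cnorm (f x).
  rewrite /f loc_act //; case: xD => _ xj.
  have [rT _ _] := iT.
  by have [] := emb_crd (rT _ (rank1_pmat ((chart_domP i x).2 x0))) xj.
(* [lim1] and [lim2] are the limits of the two sides of [ds2_act] at y = h xi + x, divided by h^2.
   The sides agree for small nonzero h, since y then lies in the open domain, so uniqueness of
   limits gives the claim. *)
have lim1 : ds2 (f x) (h^-1 *: (f (h *: xi + x) - f x)) *
    (cnorm (f x) / cnorm (f (h *: xi + x))) @[h --> 0^'] -->
    ds2 (f x) ('D_xi f x) * (cnorm (f x) / cnorm (f x)).
  apply: cvgM.
    apply: cvg_comp fd _.
    exact: (ratfun_continuous (ratfun_ds2 setT (f x)) I).
  apply: cvgM; first exact: cvg_cst.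
  apply: cvgV; first by rewrite gt_eqF.
  exact: cvg_comp (cvg_comp _ _ lcw fc) (cc _).
have lim2 : ds2 x xi * (cnorm x / cnorm (h *: xi + x)) @[h --> 0^'] -->
    ds2 x xi * (cnorm x / cnorm x).
  apply: cvgM; first exact: cvg_cst.
  apply: cvgM; first exact: cvg_cst.
  apply: cvgV; first by rewrite gt_eqF.
  exact: cvg_comp lcw (cc _).
have xN : nbhs x (actdom T i j) by exact: open_nbhs_nbhs.
have eq12 : \forall h \near (0 : R)^', ds2 (f x) (h^-1 *: (f (h *: xi + x) - f x)) *
    (cnorm (f x) / cnorm (f (h *: xi + x))) =
    ds2 x xi * (cnorm x / cnorm (h *: xi + x)).
  near=> h.
  have h0 : h != 0 by near: h; exact: nbhs_dnbhs_neq.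
  have hD : actdom T i j (h *: xi + x).
    by near: h; exact: lcw _ xN.
  have := ds2_act iT xD hD; rewrite /= -/f addrK ds2Z => e.
  by rewrite ds2Z -mulrA e exprVn -mulrA mulKf // expf_neq0.
have lim3 : ds2 x xi * (cnorm x / cnorm (h *: xi + x)) @[h --> 0^'] -->
    ds2 (f x) ('D_xi f x) * (cnorm (f x) / cnorm (f x)).
  exact: cvg_trans (near_eq_cvg eq12) lim1.
have := cvg_lim (@Rhausdorff R) lim3; rewrite (cvg_lim (@Rhausdorff R) lim2).
by rewrite !divff ?gt_eqF // !mulr1 => ->.
Unshelve. all: by end_near. Qed.

End Isometries.

(* O'P^2 with the metric g is homogeneous: the isometry group acts transitively. *)
Theorem theorem6p6 (R : realType) (p q : set (trip R)) :
  is_point p -> is_point q ->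
  exists F : set (trip R) -> set (trip R), opp_isometry F /\ F p = q.
Proof.
move=> [t [tU ->]] [s [sU ->]].
have [T [T' [aT Tt]]] := herm_aut_transitive (rank1_pmat tU) (rank1_pmat sU).
have [iT iT' _ _] := aT.
exists (act T); split; last by rewrite act_eqclass // Tt eqclassE.
split; last exact: preserves_metric_act.
split; first exact: smooth_act.
exists (act T'); split; first exact: smooth_act.
by split=> p' hp'; [exact: actK aT hp'|exact: actK (herm_aut_sym aT) hp'].
Qed.
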